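(* Let $\rho_1,\rho_2\in\mathbb{C}$ be arbitrary parameters and consider the system of two ordinary differential equations $$\dot y_1(t)=[y_1(t)]^2,\qquad \dot y_2(t)=\rho_1[y_1(t)]^2+\rho_2\,y_1(t)\,y_2(t)+[y_2(t)]^2 .$$ Set $$\Delta=\sqrt{(1-\rho_2)^2-4\rho_1},\qquad u_\pm=\frac{1-\rho_2\pm\Delta}{2}$$ (either choice of the square root), and assume $\Delta\neq 0$. Let $y_1(0),y_2(0)\in\mathbb{C}$ be arbitrary initial data. (i) If $y_1(0)\neq 0$, the solution of the initial-value problem is $$y_1(t)=\frac{y_1(0)}{1-y_1(0)t},\qquad y_2(t)=\frac{y_1(0)}{1-y_1(0)t}\,u(t),$$ where $u(0)=y_2(0)/y_1(0)$ and $$u(t)=\frac{u_+\,[u(0)-u_-]-u_-\,[u(0)-u_+]\,[1-y_1(0)t]^{-\Delta}}{u(0)-u_- -[u(0)-u_+]\,[1-y_1(0)t]^{-\Delta}} .$$ (ii) If $y_1(0)=0$, the solution is $y_1(t)=0$, $y_2(t)=y_2(0)\,[1-y_2(0)t]^{-1}$.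
   Context: Dots denote differentiation with respect to the independent variable $t$ (''time''); all parameters and dependent variables may be complex. The formulas hold on any interval of $t$ containing $0$ on which the denominators appearing in them do not vanish; the power $[1-y_1(0)t]^{-\Delta}$ denotes the continuous branch along that interval that equals $1$ at $t=0$. *)

(* Defs.v *)
From Stdlib Require Import Reals.
From Coquelicot Require Import Coquelicot.

Open Scope C_scope.

Definition Cexp (z : C) : C :=
  (exp (Re z) * cos (Im z), exp (Re z) * sin (Im z))%R.

(** Intervals of any kind: open, closed or half-open, bounded or not. *)
Definition is_interval (I : R -> Prop) : Prop :=
  forall a b t : R, I a -> I b -> (a <= t <= b)%R -> I t.

(** [is_derive] with [locally t] restricted to [I]: this is the usual
    derivative at interior points of [I] and the one-sided derivative at an
    endpoint that belongs to [I]. *)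
Definition is_derive_in (I : R -> Prop) (f : R -> C) (t : R) (l : C) : Prop :=
  filterdiff (K := R_AbsRing) (U := R_NormedModule) (V := C_R_NormedModule)
    f (within I (locally t)) (fun h : R => scal h l).

(** [P] is, along [I], the continuous branch of [g ^ alpha] equal to 1 at 0:
    [P = exp (alpha * L)] with [L] a continuous branch of [log g] on [I]. *)
Definition is_power_branch (I : R -> Prop) (g : R -> C) (alpha : C)
    (P : R -> C) : Prop :=
  (exists L : R -> C,
     continuous_on (T := R_UniformSpace) (U := C_UniformSpace) I L /\
     (forall t : R, I t -> Cexp (L t) = g t /\ P t = Cexp (alpha * L t))) /\
  P 0%R = 1.

Definition is_ivp_solution (rho1 rho2 : C) (I : R -> Prop) (y10 y20 : C)
    (y1 y2 : R -> C) : Prop :=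
  y1 0%R = y10 /\ y2 0%R = y20 /\
  forall t : R, I t ->
    is_derive_in I y1 t (y1 t ^ 2) /\
    is_derive_in I y2 t (rho1 * y1 t ^ 2 + rho2 * y1 t * y2 t + y2 t ^ 2).

(* Main.v *)
Require Import Defs.
From Stdlib Require Import Reals Lra.
From Coquelicot Require Import Coquelicot.
Open Scope C_scope.

(** The explicit functions solve the system, and the system has at most one
    solution on an interval containing 0; the two facts together give both
    directions of each equivalence.

    For existence, write [y1 = y10 / (1 - y10 t)] and [y2 = y1 u].  The second
    equation becomes the separable equation [u' = y1 (u - up) (u - um)], since
    [up] and [um] have sum [1 - rho2] and product [rho1].  Unless [u] is
    constantly [um], the ratio [(u - up) / (u - um)] is then a multiple of
    [P = (1 - y10 t) ^ (- Delta)], as [P' = Delta y1 P].  The formula is checked by differentiation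
    ([explicit_formula_solves]).  The derivative of [P] follows from the continuity
    of the branch of the logarithm alone ([is_derive_in_power]), and a branch
    exists because the path [1 - y10 t] never meets the nonpositive reals
    ([slit_plane_on_interval]).

    For uniqueness, the difference of two solutions of a scalar Riccati equation
    solves a homogeneous linear equation with continuous coefficient, to which
    Gronwall's argument applies ([linear_ode_zero], [riccati_unique]).

    Derivatives along an interval, one-sided at the endpoints, are handled
    through slope functions ([is_derive_in_slope]). *)

(** * Limits in the complex plane *)

(** The uniform structure of [C] as a product and the one of its absolute ring,
    given by [Cmod], are not convertible; convergence is fixed here for the
    first, and [Clim_Cmod] and [Clim_AbsRing] pass to the second. *)
Definition Clim {T : Type} (F : (T -> Prop) -> Prop) (f : T -> C) (l : C) : Prop :=
  filterlim f F (locally (T := C_UniformSpace) l).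

Lemma Clim_Cmod {T : Type} (F : (T -> Prop) -> Prop) {FF : Filter F} (f : T -> C) (l : C) :
  Clim F f l <-> forall eps : posreal, F (fun x => (Cmod (f x - l) < eps)%R).
Proof.
  exact (filterlim_locally_ball_norm (U := C_NormedModule) f l).
Qed.

Lemma Clim_AbsRing {T : Type} (F : (T -> Prop) -> Prop) {FF : Filter F} (f : T -> C) (l : C) :
  Clim F f l <-> filterlim f F (locally (T := AbsRing_UniformSpace C_AbsRing) l).
Proof.
  rewrite Clim_Cmod by exact FF. symmetry.
  exact (filterlim_locally (U := AbsRing_UniformSpace C_AbsRing) f l).
Qed.

Lemma Clim_const {T : Type} (F : (T -> Prop) -> Prop) {FF : Filter F} (c : C) :
  Clim F (fun _ => c) c.
Proof. apply filterlim_const. Qed.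

Lemma Clim_plus {T : Type} (F : (T -> Prop) -> Prop) {FF : Filter F} (f g : T -> C) (l m : C) :
  Clim F f l -> Clim F g m -> Clim F (fun x => f x + g x) (l + m).
Proof.
  intros Hf Hg.
  exact (filterlim_comp_2 f g Cplus Hf Hg (filterlim_plus (V := C_R_NormedModule) l m)).
Qed.

Lemma Clim_mult {T : Type} (F : (T -> Prop) -> Prop) {FF : Filter F} (f g : T -> C) (l m : C) :
  Clim F f l -> Clim F g m -> Clim F (fun x => f x * g x) (l * m).
Proof.
  rewrite !Clim_AbsRing by exact FF. intros Hf Hg.
  exact (filterlim_comp_2 f g Cmult Hf Hg (filterlim_mult (K := C_AbsRing) l m)).
Qed.

Lemma Clim_inv {T : Type} (F : (T -> Prop) -> Prop) {FF : Filter F} (f : T -> C) (l : C) :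
  l <> 0 -> Clim F f l -> Clim F (fun x => / f x) (/ l).
Proof.
  intros Hl Hf. rewrite Clim_Cmod by exact FF. intros eps.
  rewrite Clim_Cmod in Hf by exact FF.
  assert (Pl : (0 < Cmod l)%R) by now apply Cmod_gt_0.
  assert (Hd : (0 < Rmin (Cmod l / 2) (eps * (Cmod l * Cmod l) / 2))%R).
  { apply Rmin_glb_lt. lra.
    pose proof (cond_pos eps). apply Rdiv_lt_0_compat; [|lra].
    apply Rmult_lt_0_compat; [easy|]. now apply Rmult_lt_0_compat. }
  refine (filter_imp _ _ _ (Hf (mkposreal _ Hd))). simpl.
  intros x Hx.
  assert (H1 := Rlt_le_trans _ _ _ Hx (Rmin_l _ _)).
  assert (H2 := Rlt_le_trans _ _ _ Hx (Rmin_r _ _)).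
  assert (H3 : (Cmod l / 2 < Cmod (f x))%R).
  { pose proof (Cmod_triangle (f x) (l - f x)) as H.
    replace (f x + (l - f x)) with l in H by ring.
    replace (Cmod (l - f x)) with (Cmod (f x - l)) in H
      by (rewrite <- Cmod_opp; f_equal; ring). lra. }
  assert (Hfx : f x <> 0) by (apply Cmod_gt_0; lra).
  replace (/ f x - / l) with (- ((f x - l) / (f x * l))) by now field.
  rewrite Cmod_opp, Cmod_div, Cmod_mult by now apply Cmult_neq_0.
  assert (Q : (0 < Cmod (f x) * Cmod l)%R) by (apply Rmult_lt_0_compat; lra).
  apply (Rmult_lt_reg_r _ _ _ Q).
  unfold Rdiv. rewrite Rmult_assoc, Rinv_l, Rmult_1_r by lra.
  apply (Rlt_le_trans _ _ _ H2).
  pose proof (cond_pos eps).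
  assert (0 < eps * Cmod l)%R by now apply Rmult_lt_0_compat. nra.
Qed.

Lemma Clim_neq_0 {T : Type} (F : (T -> Prop) -> Prop) {FF : Filter F} (f : T -> C) (l : C) :
  l <> 0 -> Clim F f l -> F (fun x => f x <> 0).
Proof.
  intros Hl Hf. rewrite Clim_Cmod in Hf by exact FF.
  refine (filter_imp _ _ _ (Hf (mkposreal _ (proj1 (Cmod_gt_0 l) Hl)))). simpl.
  intros x Hx E. rewrite E in Hx.
  replace (0 - l) with (- l) in Hx by ring. rewrite Cmod_opp in Hx. lra.
Qed.

(** * Derivatives along an interval *)

Notation near I t := (within I (locally (T := R_UniformSpace) t)).

Lemma near_self (I : R -> Prop) (t : R) (Q : R -> Prop) : I t -> near I t Q -> Q t.
Proof. intros It [d Hd]. apply Hd; [apply ball_center | exact It]. Qed.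

Lemma near_in (I : R -> Prop) (t : R) : near I t I.
Proof. unfold within. apply filter_forall. auto. Qed.

Lemma Clim_id (I : R -> Prop) (t : R) : Clim (near I t) (fun s => RtoC s) (RtoC t).
Proof.
  apply Clim_Cmod; [typeclasses eauto|]. intros eps.
  exists eps. intros s Hs _.
  rewrite <- RtoC_minus, Cmod_R. exact Hs.
Qed.

(** Caratheodory's form of the derivative: the increment is exactly [s - t]
    times a slope function tending to the derivative.  It turns the product,
    inverse and chain rules into algebraic identities between slopes. *)
Lemma is_derive_in_slope (I : R -> Prop) (f : R -> C) (t : R) (l : C) :
  I t ->
  is_derive_in I f t l <->
  exists phi : R -> C,
    Clim (near I t) phi l /\
    near I t (fun s => f s - f t = (s - t) * phi s).
Proof.
  intros It.
  assert (Hlim : is_filter_lim (near I t) t).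
  { intros Q HQ. unfold within. revert HQ. apply filter_imp. auto. }
  split.
  - intros [_ H]. specialize (H t Hlim).
    exists (fun s => if Req_EM_T s t then l else (f s - f t) / (s - t)).
    split.
    + apply Clim_Cmod; [typeclasses eauto|]. intros eps.
      refine (filter_imp _ _ _ (H (pos_div_2 eps))).
      intros s Hs. simpl in Hs.
      change (@norm R_AbsRing (prod_NormedModule R_AbsRing R_NormedModule R_NormedModule)
                ((f s - f t) - (scal (V := C_R_NormedModule) (s - t)%R l))%C
              <= eps / 2 * Rabs (s - t))%R in Hs.
      rewrite <- Cmod_norm, scal_R_Cmult in Hs.
      pose proof (cond_pos eps).
      destruct (Req_EM_T s t) as [E|E].
      * replace (l - l) with (RtoC 0) by ring. rewrite Cmod_0. lra.
      * assert (N : (s - t : C) <> 0).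
        { rewrite <- RtoC_minus. intros K. apply RtoC_inj in K. lra. }
        replace ((f s - f t) / (s - t) - l)
          with ((f s - f t - (s - t)%R * l) / (s - t))
          by (rewrite RtoC_minus; now field).
        assert (A : (0 < Rabs (s - t))%R) by (apply Rabs_pos_lt; lra).
        rewrite Cmod_div, <- RtoC_minus, Cmod_R by exact N.
        apply (Rmult_lt_reg_r _ _ _ A).
        unfold Rdiv. rewrite Rmult_assoc, Rinv_l by lra. nra.
    + unfold within. apply filter_forall. intros s _.
      destruct (Req_EM_T s t) as [->|E]; [ring|].
      assert (N : (s - t : C) <> 0).
      { rewrite <- RtoC_minus. intros K. apply RtoC_inj in K. lra. }
      now field.
  - intros [phi [Hphi Hf]]. split.
    + exact (is_linear_scal_l (V := C_R_NormedModule) l).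
    + intros x Hx.
      assert (E : t = x).
      { assert (PF : ProperFilter' (near I t)).
        { constructor; [|typeclasses eauto].
          intros K. exact (near_self I t _ It K). }
        exact (is_filter_lim_unique (V := R_NormedModule) _ _ Hlim Hx). }
      subst x. intros eps.
      rewrite Clim_Cmod in Hphi by typeclasses eauto.
      refine (filter_imp _ _ _ (filter_and _ _ (Hphi eps) Hf)).
      intros s [H1 H2].
      change (@norm R_AbsRing (prod_NormedModule R_AbsRing R_NormedModule R_NormedModule)
                ((f s - f t) - (scal (V := C_R_NormedModule) (s - t)%R l))%C
              <= eps * Rabs (s - t))%R.
      rewrite <- Cmod_norm, scal_R_Cmult, H2, RtoC_minus.
      replace ((s - t) * phi s - (s - t) * l) with ((phi s - l) * (s - t)) by ring.
      rewrite Cmod_mult, <- RtoC_minus, Cmod_R.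
      apply Rmult_le_compat_r; [apply Rabs_pos | lra].
Qed.

Lemma is_derive_in_continuous (I : R -> Prop) (t : R) (It : I t) (f : R -> C) (l : C) :
  is_derive_in I f t l -> Clim (near I t) f (f t).
Proof.
  intros H. apply is_derive_in_slope in H; [|exact It].
  destruct H as [phi [Hphi Hf]].
  apply (filterlim_ext_loc (fun s : R => f t + (s + - t) * phi s)).
  - refine (filter_imp _ _ _ Hf). intros s Hs.
    replace (f s) with (f t + (f s - f t)) by ring. rewrite Hs. ring.
  - assert (K : Clim (near I t) (fun s : R => f t + (s + - t) * phi s)
                  (f t + (t + - t) * l)).
    { apply Clim_plus; [typeclasses eauto|apply Clim_const; typeclasses eauto|].
      apply Clim_mult; [typeclasses eauto| |exact Hphi].
      apply Clim_plus; [typeclasses eauto|apply Clim_id|apply Clim_const; typeclasses eauto]. }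
    replace (f t + (t + - t) * l) with (f t) in K by ring. exact K.
Qed.

Lemma is_derive_in_ext (I : R -> Prop) (t : R) (It : I t) (f g : R -> C) (l : C) :
  (forall s, I s -> f s = g s) -> is_derive_in I f t l -> is_derive_in I g t l.
Proof.
  intros E H. apply is_derive_in_slope in H; [|exact It].
  apply is_derive_in_slope; [exact It|].
  destruct H as [phi [Hphi Hf]]. exists phi. split; [exact Hphi|].
  refine (filter_imp _ _ _ (filter_and _ _ Hf (near_in I t))).
  intros s [Hs Is]. now rewrite <- !E.
Qed.

Lemma is_derive_in_const (I : R -> Prop) (t : R) (It : I t) (c : C) : is_derive_in I (fun _ => c) t 0.
Proof.
  apply is_derive_in_slope; [exact It|]. exists (fun _ => 0).
  split; [apply Clim_const; typeclasses eauto|]. unfold within. apply filter_forall. intros s _. ring.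
Qed.

Lemma is_derive_in_id (I : R -> Prop) (t : R) (It : I t) : is_derive_in I (fun s => RtoC s) t 1.
Proof.
  apply is_derive_in_slope; [exact It|]. exists (fun _ => 1).
  split; [apply Clim_const; typeclasses eauto|]. unfold within. apply filter_forall. intros s _. ring.
Qed.

Lemma is_derive_in_plus (I : R -> Prop) (t : R) (It : I t) (f g : R -> C) (l m : C) :
  is_derive_in I f t l -> is_derive_in I g t m ->
  is_derive_in I (fun s => f s + g s) t (l + m).
Proof.
  rewrite !is_derive_in_slope by exact It.
  intros [phi [Hphi Hf]] [psi [Hpsi Hg]].
  exists (fun s => phi s + psi s). split; [now apply Clim_plus; [typeclasses eauto | |]|].
  refine (filter_imp _ _ _ (filter_and _ _ Hf Hg)). intros s [Ef Eg].
  replace (f s + g s - (f t + g t)) with ((f s - f t) + (g s - g t)) by ring.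
  rewrite Ef, Eg. ring.
Qed.

Lemma is_derive_in_mult (I : R -> Prop) (t : R) (It : I t) (f g : R -> C) (l m : C) :
  is_derive_in I f t l -> is_derive_in I g t m ->
  is_derive_in I (fun s => f s * g s) t (l * g t + f t * m).
Proof.
  intros Df Dg. pose proof (is_derive_in_continuous I t It _ _ Dg) as Cg.
  revert Df Dg. rewrite !is_derive_in_slope by exact It.
  intros [phi [Hphi Hf]] [psi [Hpsi Hg]].
  exists (fun s => phi s * g s + f t * psi s). split.
  - apply Clim_plus; [typeclasses eauto| |].
    + now apply Clim_mult; [typeclasses eauto| |].
    + now apply Clim_mult; [typeclasses eauto|apply Clim_const; typeclasses eauto|].
  - refine (filter_imp _ _ _ (filter_and _ _ Hf Hg)). intros s [Ef Eg].
    replace (f s * g s - f t * g t) with ((f s - f t) * g s + f t * (g s - g t)) by ring.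
    rewrite Ef, Eg. ring.
Qed.

Lemma is_derive_in_inv (I : R -> Prop) (t : R) (It : I t) (f : R -> C) (l : C) :
  f t <> 0 -> is_derive_in I f t l ->
  is_derive_in I (fun s => / f s) t (- l / (f t * f t)).
Proof.
  intros Nf Df. pose proof (is_derive_in_continuous I t It _ _ Df) as Cf.
  pose proof (Clim_neq_0 _ _ _ Nf Cf) as Nfs.
  revert Df. rewrite !is_derive_in_slope by exact It.
  intros [phi [Hphi Hf]].
  exists (fun s => (- (1)) * phi s * (/ f s * / f t)). split.
  - replace (- l / (f t * f t)) with ((- (1)) * l * (/ f t * / f t)) by now field.
    repeat (apply Clim_mult; [typeclasses eauto| |]);
      try (apply Clim_const; typeclasses eauto); trivial.
    now apply Clim_inv; [typeclasses eauto| |].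
  - refine (filter_imp _ _ _ (filter_and _ _ Hf Nfs)). intros s [Ef Ns].
    replace (/ f s - / f t) with ((- (1)) * (f s - f t) * (/ f s * / f t)) by now field.
    rewrite Ef. ring.
Qed.

(** * The complex exponential and continuous branches of powers *)

Lemma Cexp_0 : Cexp 0 = 1.
Proof.
  unfold Cexp. simpl. rewrite exp_0, cos_0, sin_0. unfold RtoC. f_equal; ring.
Qed.

Lemma Cexp_plus (z w : C) : Cexp (z + w) = Cexp z * Cexp w.
Proof.
  destruct z as [a b], w as [c d]. unfold Cexp, Cplus, Cmult, Re, Im. simpl.
  rewrite exp_plus, cos_plus, sin_plus. f_equal; ring.
Qed.

Lemma Cexp_neq_0 (z : C) : Cexp z <> 0.
Proof.
  intros H. apply C1_nz. rewrite <- Cexp_0.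
  replace (RtoC 0) with (z + - z) by ring. rewrite Cexp_plus, H. ring.
Qed.

Lemma Cmod_le_abs (a b : R) : (Cmod (a, b) <= Rabs a + Rabs b)%R.
Proof.
  pose proof (Rabs_pos a). pose proof (Rabs_pos b).
  unfold Cmod. simpl fst. simpl snd.
  rewrite <- (sqrt_pow2 (Rabs a + Rabs b)) by lra.
  apply sqrt_le_1_alt.
  rewrite <- (pow2_abs a), <- (pow2_abs b). nra.
Qed.

Lemma derivable_pt_lim_0_domin (f : R -> R) (l : R) :
  derivable_pt_lim f 0 l ->
  forall e : R, (0 < e)%R ->
  exists d : R, (0 < d)%R /\
    forall h, (Rabs h < d)%R -> (Rabs (f h - f 0 - l * h) <= e * Rabs h)%R.
Proof.
  intros H e He. destruct (H e He) as [d Hd]. exists d. split; [apply cond_pos|].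
  intros h Hh. destruct (Req_dec h 0) as [->|N].
  - replace (f 0 - f 0 - l * 0)%R with 0%R by ring. rewrite Rabs_R0. lra.
  - specialize (Hd h N Hh). rewrite Rplus_0_l in Hd.
    replace (f h - f 0 - l * h)%R with (((f h - f 0) / h - l) * h)%R by now field.
    rewrite Rabs_mult. apply Rmult_le_compat_r; [apply Rabs_pos | lra].
Qed.

(** With [w = (a, b)], the two components of [Cexp w - 1 - w] are
    [(exp a - 1 - a) cos b + (1 + a) (cos b - 1)] and
    [(exp a - 1) sin b + (sin b - b)], so the first-order expansions of [exp],
    [cos] and [sin] at 0 suffice. *)
Lemma Cexp_domin (eps : posreal) :
  exists d : R, (0 < d)%R /\
    forall w : C, (Cmod w < d)%R -> (Cmod (Cexp w - 1 - w) <= eps * Cmod w)%R.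
Proof.
  (* The components are bounded by [3 e |w|] and [5 e |w|], whence the 8. *)
  set (e := Rmin 1 (eps / 8)).
  pose proof (cond_pos eps) as Heps.
  assert (He : (0 < e)%R) by (apply Rmin_glb_lt; lra).
  assert (He1 : (e <= 1)%R) by apply Rmin_l.
  assert (He8 : (e <= eps / 8)%R) by apply Rmin_r.
  clearbody e.
  destruct (derivable_pt_lim_0_domin _ _ derivable_pt_lim_exp_0 e He) as [d1 [P1 H1]].
  destruct (derivable_pt_lim_0_domin _ _ derivable_pt_lim_cos_0 e He) as [d2 [P2 H2]].
  destruct (derivable_pt_lim_0_domin _ _ derivable_pt_lim_sin_0 e He) as [d3 [P3 H3]].
  exists (Rmin e (Rmin d1 (Rmin d2 d3))). split.
  { repeat apply Rmin_glb_lt; assumption. }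
  intros [a b] Hw.
  pose proof (Rmax_Cmod (a, b)) as Hm. simpl in Hm.
  pose proof (Rle_trans _ _ _ (Rmax_l _ _) Hm) as Ha.
  pose proof (Rle_trans _ _ _ (Rmax_r _ _) Hm) as Hb.
  set (m := Cmod (a, b)) in *. clearbody m. clear Hm.
  pose proof (Rmin_l e (Rmin d1 (Rmin d2 d3))).
  pose proof (Rmin_r e (Rmin d1 (Rmin d2 d3))).
  pose proof (Rmin_l d1 (Rmin d2 d3)).
  pose proof (Rmin_r d1 (Rmin d2 d3)).
  pose proof (Rmin_l d2 d3). pose proof (Rmin_r d2 d3).
  specialize (H1 a ltac:(lra)). specialize (H2 b ltac:(lra)). specialize (H3 b ltac:(lra)).
  rewrite exp_0 in H1. rewrite cos_0 in H2. rewrite sin_0 in H3.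
  replace (exp a - 1 - 1 * a)%R with (exp a - 1 - a)%R in H1 by ring.
  replace (cos b - 1 - 0 * b)%R with (cos b - 1)%R in H2 by ring.
  replace (sin b - 0 - 1 * b)%R with (sin b - b)%R in H3 by ring.
  pose proof (Rabs_pos a). pose proof (Rabs_pos b).
  replace (Cexp (a, b) - 1 - (a, b)) with
    (((exp a - 1 - a) * cos b + (1 + a) * (cos b - 1))%R,
     ((exp a - 1) * sin b + (sin b - b))%R).
  2:{ unfold Cexp, Re, Im, Cminus, Cplus, Copp, RtoC. simpl. f_equal; ring. }
  eapply Rle_trans; [apply Cmod_le_abs|].
  assert (B1 : (Rabs ((exp a - 1 - a) * cos b + (1 + a) * (cos b - 1)) <= 3 * e * m)%R).
  { eapply Rle_trans; [apply Rabs_triang|]. rewrite !Rabs_mult.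
    assert (Rabs (cos b) <= 1)%R.
    { apply Rabs_le. destruct (COS_bound b). lra. }
    assert (Rabs (1 + a) <= 2)%R.
    { eapply Rle_trans; [apply Rabs_triang|]. rewrite Rabs_R1. lra. }
    assert (Rabs (exp a - 1 - a) * Rabs (cos b) <= e * m * 1)%R.
    { apply Rmult_le_compat; try apply Rabs_pos; [nra|assumption]. }
    assert (Rabs (1 + a) * Rabs (cos b - 1) <= 2 * (e * m))%R.
    { apply Rmult_le_compat; try apply Rabs_pos; [assumption|nra]. }
    lra. }
  assert (B2 : (Rabs ((exp a - 1) * sin b + (sin b - b)) <= 5 * e * m)%R).
  { eapply Rle_trans; [apply Rabs_triang|]. rewrite !Rabs_mult.
    assert (Rabs (exp a - 1) <= 2 * e)%R.
    { replace (exp a - 1)%R with ((exp a - 1 - a) + a)%R by ring.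
      eapply Rle_trans; [apply Rabs_triang|]. nra. }
    assert (Rabs (sin b) <= 2 * m)%R.
    { replace (sin b) with ((sin b - b) + b)%R by ring.
      eapply Rle_trans; [apply Rabs_triang|]. nra. }
    assert (Rabs (exp a - 1) * Rabs (sin b) <= 2 * e * (2 * m))%R.
    { apply Rmult_le_compat; try apply Rabs_pos; assumption. }
    nra. }
  nra.
Qed.

Lemma Cexp_slope :
  exists E : C -> C,
    (forall w, Cexp w - 1 = w * E w) /\ Clim (locally (T := C_UniformSpace) (RtoC 0)) E 1.
Proof.
  exists (fun w => if Ceq_dec w 0 then RtoC 1 else (Cexp w - 1) / w). split.
  - intros w. destruct (Ceq_dec w 0) as [->|N]; [rewrite Cexp_0; ring | now field].
  - apply Clim_Cmod; [typeclasses eauto|]. intros eps.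
    destruct (Cexp_domin (pos_div_2 eps)) as [d [Pd Hd]]. simpl in Hd.
    pose proof (cond_pos eps).
    assert (L : Clim (locally (T := C_UniformSpace) (RtoC 0)) (fun w => w) 0)
      by apply filterlim_id.
    rewrite Clim_Cmod in L by typeclasses eauto.
    refine (filter_imp _ _ _ (L (mkposreal d Pd))). simpl.
    intros w Hw. replace (w - 0) with w in Hw by ring.
    destruct (Ceq_dec w 0) as [E|N].
    + replace (1 - 1) with (RtoC 0) by ring. rewrite Cmod_0. lra.
    + specialize (Hd w Hw).
      pose proof (proj1 (Cmod_gt_0 w) N) as Pw.
      replace ((Cexp w - 1) / w - 1) with ((Cexp w - 1 - w) / w) by now field.
      rewrite Cmod_div by exact N. apply (Rmult_lt_reg_r _ _ _ Pw).
      unfold Rdiv. rewrite Rmult_assoc, Rinv_l by lra. nra.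
Qed.

(** The derivative comes from the continuity of the logarithm [L]: the
    increment [w = L s - L t] tends to 0, and [g s / g t - 1 = Cexp w - 1] is [w]
    times a slope tending to 1, so [w] is recovered from the increment of [g] by
    a division.  The increment of [P] is then [P t * (Cexp (alpha * w) - 1)]. *)
Lemma is_derive_in_power (I : R -> Prop) (g L P : R -> C) (alpha l : C) (t : R) :
  I t ->
  continuous_on (T := R_UniformSpace) (U := C_UniformSpace) I L ->
  (forall s, I s -> Cexp (L s) = g s /\ P s = Cexp (alpha * L s)) ->
  is_derive_in I g t l ->
  is_derive_in I P t (alpha * (l / g t) * P t).
Proof.
  intros It HL HP. rewrite !is_derive_in_slope by exact It. intros [phi [Hphi Hg]].
  destruct Cexp_slope as [E [HE LE]].
  set (w := fun s => L s + - L t).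
  assert (Lw : Clim (near I t) w 0).
  { replace (RtoC 0) with (L t + - L t) by ring.
    apply Clim_plus; [typeclasses eauto|exact (HL t It)|apply Clim_const; typeclasses eauto]. }
  assert (LEw : Clim (near I t) (fun s => E (w s)) 1) by exact (filterlim_comp _ _ _ _ _ _ _ _ Lw LE).
  assert (LEaw : Clim (near I t) (fun s => E (alpha * w s)) 1).
  { refine (filterlim_comp _ _ _ (fun s => alpha * w s) E _ _ _ _ LE).
    assert (K : Clim (near I t) (fun s => alpha * w s) (alpha * 0)).
    { apply Clim_mult; [typeclasses eauto|apply Clim_const; typeclasses eauto|exact Lw]. }
    replace (alpha * 0) with (RtoC 0) in K by ring. exact K. }
  assert (Ng : g t <> 0).
  { rewrite <- (proj1 (HP t It)). apply Cexp_neq_0. }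
  exists (fun s => alpha * (phi s * / g t) * P t * (/ E (w s) * E (alpha * w s))). split.
  - replace (alpha * (l / g t) * P t) with (alpha * (l * / g t) * P t * (/ 1 * 1))
      by (field; exact Ng).
    repeat (apply Clim_mult; [typeclasses eauto| |]);
      try (apply Clim_const; typeclasses eauto); trivial.
    apply Clim_inv; [typeclasses eauto|apply C1_nz|exact LEw].
  - pose proof (Clim_neq_0 _ _ _ C1_nz LEw) as NE.
    refine (filter_imp _ _ _ (filter_and _ _ (filter_and _ _ Hg NE) (near_in I t))).
    intros s [[Eg Ns] Is].
    destruct (HP s Is) as [Gs ->]. destruct (HP t It) as [Gt ->].
    assert (Ls : L s = L t + w s) by (unfold w; ring).
    assert (Eg' : g t * (w s * E (w s)) = (s - t) * phi s).
    { rewrite <- Eg, <- HE, <- Gs, <- Gt, Ls, Cexp_plus. ring. }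
    rewrite Ls.
    replace (alpha * (L t + w s)) with (alpha * L t + alpha * w s) by ring.
    rewrite Cexp_plus.
    replace (Cexp (alpha * L t) * Cexp (alpha * w s) - Cexp (alpha * L t))
      with (Cexp (alpha * L t) * (Cexp (alpha * w s) - 1)) by ring.
    rewrite HE.
    transitivity (alpha * (((s - t) * phi s) * / g t) * Cexp (alpha * L t)
                  * (/ E (w s) * E (alpha * w s))); [|ring].
    rewrite <- Eg'. field. now split.
Qed.

(** Principal logarithm on the plane slit along the nonpositive reals, with
    the argument written by the half-angle formula. *)
Definition Clog (z : C) : C :=
  (ln (Cmod z), (2 * atan (Im z / (Re z + Cmod z)))%R).

Lemma Cexp_Clog (z : C) : (0 < Re z + Cmod z)%R -> Cexp (Clog z) = z.
Proof.
  destruct z as [x y]. intros H. unfold Re, Im in *. simpl in H.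
  unfold Cexp, Clog, Re, Im. simpl.
  assert (Hr : (0 < Cmod (x, y))%R).
  { pose proof (re_le_Cmod (x, y)) as K. simpl in K. apply Rabs_le_between in K. lra. }
  assert (Hs : (Cmod (x, y) ^ 2 = x ^ 2 + y ^ 2)%R) by exact (Cmod2_alt (x, y)).
  set (r := Cmod (x, y)) in *. clearbody r.
  rewrite exp_ln by exact Hr.
  rewrite cos_2a, sin_2a, cos_atan, sin_atan.
  set (u := (y / (x + r))%R).
  assert (Pu : (0 < 1 + u²)%R) by (pose proof (Rle_0_sqr u); lra).
  pose proof (sqrt_lt_R0 _ Pu) as Ps.
  assert (Q : (sqrt (1 + u²) * sqrt (1 + u²) = 1 + u²)%R) by (apply sqrt_sqrt; lra).
  assert (Hu : (1 + u² = 2 * r / (x + r))%R).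
  { unfold u, Rsqr. field_simplify_eq; [|lra]. nra. }
  set (q := sqrt (1 + u²)) in *. clearbody q.
  f_equal.
  - replace (r * (1 / q * (1 / q) - u / q * (u / q)))%R
      with (r * (1 - u²) / (q * q))%R by (unfold Rsqr; field; lra).
    rewrite Q, Hu. replace (1 - u²)%R with (2 - (1 + u²))%R by ring. rewrite Hu.
    field. lra.
  - replace (r * (2 * (u / q) * (1 / q)))%R with (r * 2 * u / (q * q))%R by (field; lra).
    rewrite Q, Hu. unfold u. field. lra.
Qed.

(** If [1 - y * t] were a nonpositive real, then [y] would be real and [1 / y]
    would lie between 0 and [t], where [1 - y * s] vanishes.  Hence the path
    [1 - y * t] stays where the principal logarithm is continuous. *)
Lemma slit_plane_on_interval (I : R -> Prop) (y : C) :
  is_interval I -> I 0%R -> (forall t : R, I t -> 1 - y * t <> 0) ->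
  forall t : R, I t -> (0 < Re (1 - y * t) + Cmod (1 - y * t))%R.
Proof.
  intros HI I0 N t It.
  set (z := 1 - y * t).
  pose proof (re_le_Cmod z) as K. apply Rabs_le_between in K.
  destruct (Rle_lt_or_eq_dec 0 (Re z + Cmod z)%R) as [|E]; [lra|assumption|exfalso].
  assert (Hs : (Cmod z ^ 2 = Re z ^ 2 + Im z ^ 2)%R) by exact (Cmod2_alt z).
  assert (Iz : (Im z = 0)%R) by nra.
  pose proof (proj1 (Cmod_gt_0 z) (N t It)) as Pz.
  assert (Rz : (Re z < 0)%R) by lra.
  destruct y as [a b]. unfold z, Re, Im in Iz, Rz. simpl in Iz, Rz.
  assert (Hat : (1 < a * t)%R) by lra.
  assert (Na : a <> 0%R) by (intros ->; lra).
  assert (Nt : t <> 0%R) by (intros ->; lra).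
  assert (Hb : b = 0%R).
  { apply (Rmult_eq_reg_r t); [lra|exact Nt]. }
  assert (E1 : (a * / a = 1)%R) by (field; exact Na).
  assert (Ia : I (/ a)%R).
  { destruct (Rlt_or_le 0 t) as [P|P].
    - assert (0 < a)%R by nra.
      apply (HI 0%R t); [exact I0|exact It|]. split.
      + apply Rlt_le. now apply Rinv_0_lt_compat.
      + apply (Rmult_le_reg_l a); lra.
    - assert (a < 0)%R by nra.
      apply (HI t 0%R); [exact It|exact I0|]. split.
      + apply (Rmult_le_reg_l (- a)); lra.
      + apply Rlt_le. now apply Rinv_lt_0_compat. }
  apply (N _ Ia). rewrite Hb.
  apply injective_projections; simpl; rewrite ?E1; lra.
Qed.

Lemma Clog_affine_continuous (y : C) (t : R) :
  (0 < Re (1 - y * t) + Cmod (1 - y * t))%R ->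
  filterlim (fun s : R => Clog (1 - y * s)) (locally (T := R_UniformSpace) t)
    (locally (T := C_UniformSpace) (Clog (1 - y * t))).
Proof.
  destruct y as [a b]. intros H.
  assert (Hm : (0 < Cmod (1 - (a, b) * t))%R).
  { pose proof (re_le_Cmod (1 - (a, b) * t)) as K. apply Rabs_le_between in K. lra. }
  assert (E : forall s : R, (1 - (a, b) * s = (1 - a * s, - (b * s))%R)).
  { intros s. apply injective_projections; simpl; ring. }
  rewrite E in H, Hm. unfold Re, Im in H. simpl in H.
  assert (Hq : (0 < (1 - a * t) ^ 2 + (- (b * t)) ^ 2)%R).
  { apply sqrt_lt_0_alt. rewrite sqrt_0. exact Hm. }
  unfold Cmod in H, Hm. simpl fst in H, Hm. simpl snd in H, Hm.
  assert (C1 : continuous (T:=R_UniformSpace) (U:=R_UniformSpace) (fun s : R => ln (Cmod (1 - (a, b) * s))) t).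
  { apply (continuous_ext (fun s => ln (sqrt ((1 - a * s) ^ 2 + (- (b * s)) ^ 2)))).
    { intros s. now rewrite E. }
    apply (ex_derive_continuous (K := R_AbsRing) (V := R_NormedModule)).
    auto_derive. now repeat split. }
  assert (C2 : continuous (T:=R_UniformSpace) (U:=R_UniformSpace) (fun s : R => (2 * atan (Im (1 - (a, b) * s) /
             (Re (1 - (a, b) * s) + Cmod (1 - (a, b) * s))))%R) t).
  { apply (continuous_ext (fun s => (2 * atan (- (b * s) /
       ((1 - a * s) + sqrt ((1 - a * s) ^ 2 + (- (b * s)) ^ 2))))%R)).
    { intros s. now rewrite E. }
    apply (continuous_mult (K := R_AbsRing) (fun _ => 2%R)); [apply continuous_const|].
    apply continuous_atan_comp.
    apply (ex_derive_continuous (K := R_AbsRing) (V := R_NormedModule)).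
    auto_derive. repeat split; trivial. apply Rgt_not_eq. exact H. }
  apply (filterlim_locally (U := C_UniformSpace)). intros eps.
  unfold continuous in C1, C2. rewrite filterlim_locally in C1, C2.
  refine (filter_imp _ _ _ (filter_and _ _ (C1 eps) (C2 eps))).
  intros s [K1 K2]. split; [exact K1|exact K2].
Qed.

Lemma power_branch_exists (I : R -> Prop) (y alpha : C) :
  is_interval I -> I 0%R -> (forall t : R, I t -> 1 - y * t <> 0) ->
  exists P : R -> C, is_power_branch I (fun t => 1 - y * t) alpha P.
Proof.
  intros HI I0 N.
  pose proof (slit_plane_on_interval I y HI I0 N) as S.
  exists (fun t => Cexp (alpha * Clog (1 - y * t))). split.
  - exists (fun t : R => Clog (1 - y * t)). split.
    + intros t It.
      apply (filterlim_filter_le_1 _ (filter_le_within (F := locally t) I)).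
      now apply Clog_affine_continuous, S.
    + intros t It. split; [now apply Cexp_Clog, S | reflexivity].
  - replace (1 - y * 0%R) with (RtoC 1) by ring.
    replace (Clog 1) with (RtoC 0).
    + replace (alpha * 0) with (RtoC 0) by ring. exact Cexp_0.
    + unfold Clog. rewrite Cmod_1, ln_1. unfold RtoC. simpl.
      replace (0 / (1 + 1))%R with 0%R by field. rewrite atan_0.
      f_equal. ring.
Qed.

(** * Uniqueness for linear equations *)

Lemma is_derive_in_interior (I : R -> Prop) (f : R -> C) (t : R) (l : C) :
  locally (T := R_UniformSpace) t I -> is_derive_in I f t l ->
  is_derive (fun s => Re (f s)) t (Re l) /\ is_derive (fun s => Im (f s)) t (Im l).
Proof.
  intros HI [Hl H].
  assert (D : filterdiff (K := R_AbsRing) (U := R_NormedModule) (V := C_R_NormedModule)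
            f (locally t) (fun h : R => scal h l)).
  { split; [exact Hl|]. intros x Hx eps.
    assert (Hx' : is_filter_lim (near I t) x).
    { intros Q HQ. unfold within. generalize (Hx Q HQ). apply filter_imp. auto. }
    refine (filter_imp _ _ _ (filter_and (F := locally t) _ _ (H x Hx' eps) HI)).
    intros s [K1 K2]. now apply K1. }
  split.
  - exact (filterdiff_comp' f (fst : C_R_NormedModule -> R_NormedModule) t _ _ D
             (filterdiff_linear _ (is_linear_fst (U := R_NormedModule) (V := R_NormedModule)))).
  - exact (filterdiff_comp' f (snd : C_R_NormedModule -> R_NormedModule) t _ _ D
             (filterdiff_linear _ (is_linear_snd (U := R_NormedModule) (V := R_NormedModule)))).
Qed.

(** [clamp] retracts the line onto a compact interval.  Composing with it turns
    continuity relative to the interval, one-sided at its endpoints, into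
    continuity on the line, which the mean value and extreme value theorems
    require. *)
Definition clamp (a b t : R) : R := Rmax a (Rmin b t).

Lemma clamp_in (a b t : R) : (a <= b)%R -> (a <= clamp a b t <= b)%R.
Proof. intros H. split; [apply Rmax_l | apply Rmax_lub; [exact H | apply Rmin_l]]. Qed.

Lemma clamp_id (a b t : R) : (a <= t <= b)%R -> clamp a b t = t.
Proof. intros H. unfold clamp. rewrite Rmin_right, Rmax_right; lra. Qed.

Lemma clamp_lipschitz (a b s t : R) : (Rabs (clamp a b s - clamp a b t) <= Rabs (s - t))%R.
Proof.
  unfold clamp, Rmin. destruct (Rle_dec b s), (Rle_dec b t);
    unfold Rmax;
    repeat match goal with |- context [Rle_dec ?x ?y] => destruct (Rle_dec x y) end;
    unfold Rabs;
    repeat match goal with |- context [Rcase_abs ?x] => destruct (Rcase_abs x) end; lra.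
Qed.

Lemma clamp_continuous (I : R -> Prop) (f : R -> C) (a b : R) :
  (a <= b)%R -> (forall t, (a <= t <= b)%R -> I t) ->
  continuous_on (T := R_UniformSpace) (U := C_UniformSpace) I f ->
  forall t, continuous (T := R_UniformSpace) (U := C_UniformSpace) (fun s => f (clamp a b s)) t.
Proof.
  intros Hab HI Hf t.
  pose proof (Hf _ (HI _ (clamp_in a b t Hab))) as H.
  refine (filterlim_comp _ _ _ (clamp a b) f _ _ _ _ H).
  intros Q [d Hd]. exists d. intros s Hs.
  apply Hd; [|now apply HI, clamp_in].
  change (Rabs (clamp a b s - clamp a b t) < d)%R.
  eapply Rle_lt_trans; [apply clamp_lipschitz|exact Hs].
Qed.

Lemma continuous_components (f : R -> C) (t : R) :
  continuous (T := R_UniformSpace) (U := C_UniformSpace) f t ->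
  continuous (fun s => Re (f s)) t /\ continuous (fun s => Im (f s)) t.
Proof.
  intros H.
  assert (CRe : forall z : C, filterlim Re (locally (T := C_UniformSpace) z) (locally (Re z))).
  { intros [x y]. exact (continuous_fst (U := R_UniformSpace) (V := R_UniformSpace) x y). }
  assert (CIm : forall z : C, filterlim Im (locally (T := C_UniformSpace) z) (locally (Im z))).
  { intros [x y]. exact (continuous_snd (U := R_UniformSpace) (V := R_UniformSpace) x y). }
  split.
  - exact (filterlim_comp _ _ _ f Re _ _ _ H (CRe (f t))).
  - exact (filterlim_comp _ _ _ f Im _ _ _ H (CIm (f t))).
Qed.

(** Gronwall's argument: on the segment between 0 and [T], with [Cmod a <= M],
    the function [|w|^2 exp (- 2 M sg t)], where [sg] is the sign of [T], does
    not increase on the way from 0 to [T], because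
    [(|w|^2)' = 2 Re a |w|^2].  It vanishes at 0 and is nonnegative. *)
Lemma linear_ode_zero (I : R -> Prop) (w a : R -> C) :
  is_interval I -> I 0%R ->
  continuous_on (T := R_UniformSpace) (U := C_UniformSpace) I a ->
  (forall t, I t -> is_derive_in I w t (a t * w t)) ->
  w 0%R = 0 -> forall t, I t -> w t = 0.
Proof.
  intros HI I0 Ca Dw w0 T IT.
  set (lo := Rmin 0 T). set (hi := Rmax 0 T).
  assert (Hlh : (lo <= hi)%R) by exact (Rminmax 0 T).
  assert (HJ : forall t, (lo <= t <= hi)%R -> I t).
  { unfold lo, hi, Rmin, Rmax. intros t. destruct (Rle_dec 0 T); intros Ht.
    - now apply (HI 0%R T). - now apply (HI T 0%R). }
  assert (Cw : continuous_on (T := R_UniformSpace) (U := C_UniformSpace) I w).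
  { intros t It. exact (is_derive_in_continuous I t It w _ (Dw t It)). }
  pose proof (clamp_continuous I w lo hi Hlh HJ Cw) as Cwc.
  pose proof (clamp_continuous I a lo hi Hlh HJ Ca) as Cac.
  assert (HM : exists M : R, forall t, (lo <= t <= hi)%R -> (Cmod (a t) <= M)%R).
  { destruct (continuity_ab_maj (fun t => (Rabs (Re (a (clamp lo hi t))) + Rabs (Im (a (clamp lo hi t))))%R) lo hi Hlh)
      as [m [Hm _]].
    - intros t _. apply continuity_pt_filterlim.
      destruct (continuous_components _ _ (Cac t)) as [K1 K2].
      apply (continuous_plus (V := R_NormedModule)
               (fun s => Rabs (Re (a (clamp lo hi s)))) (fun s => Rabs (Im (a (clamp lo hi s))))).
      + exact (filterlim_comp _ _ _ _ Rabs _ _ _ K1 (continuous_Rabs _)).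
      + exact (filterlim_comp _ _ _ _ Rabs _ _ _ K2 (continuous_Rabs _)).
    - eexists. intros t Ht. specialize (Hm t Ht). simpl in Hm.
      rewrite (clamp_id lo hi t Ht) in Hm.
      eapply Rle_trans; [|exact Hm].
      rewrite (surjective_pairing (a t)). apply Cmod_le_abs. }
  destruct HM as [M HM].
  set (sg := if Rle_dec 0 T then 1%R else (-1)%R).
  assert (Hsg : (T = sg * Rabs T)%R).
  { unfold sg. destruct (Rle_dec 0 T); [rewrite Rabs_pos_eq|rewrite Rabs_left]; lra. }
  assert (Hsg2 : (sg * sg = 1)%R) by (unfold sg; destruct (Rle_dec 0 T); ring).
  set (N := fun t => (Re (w (clamp lo hi t)) ^ 2 + Im (w (clamp lo hi t)) ^ 2)%R).
  set (K := fun t => (N t * exp (- (2 * M * sg * t)))%R).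
  set (dK := fun t => ((2 * (Re (w t) * Re (a t * w t) + Im (w t) * Im (a t * w t))
                       - 2 * M * sg * (Re (w t) ^ 2 + Im (w t) ^ 2))
                       * exp (- (2 * M * sg * t)))%R).
  destruct (MVT_gen K 0 T dK) as [c [Hc EK]].
  - intros t Ht. fold lo hi in Ht.
    assert (Hloc : locally (T := R_UniformSpace) t (fun s => (lo < s < hi)%R)).
    { apply (open_and _ _ (open_gt lo) (open_lt hi)). exact Ht. }
    destruct (is_derive_in_interior I w t (a t * w t)) as [D1 D2].
    { refine (filter_imp _ _ _ Hloc). intros s Hs. apply HJ. lra. }
    { apply Dw, HJ. lra. }
    apply (is_derive_ext_loc (fun s => ((Re (w s) ^ 2 + Im (w s) ^ 2) * exp (- (2 * M * sg * s)))%R)).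
    { refine (filter_imp _ _ _ Hloc). intros s Hs. unfold K, N.
      now rewrite clamp_id by lra. }
    evar_last.
    + apply (is_derive_mult (K := R_AbsRing)); [| |exact Rmult_comm].
      * apply (is_derive_plus (K := R_AbsRing) (V := R_NormedModule)).
        -- apply (is_derive_pow _ 2 _ _ D1).
        -- apply (is_derive_pow _ 2 _ _ D2).
      * auto_derive; [trivial|reflexivity].
    + unfold dK, plus, mult; simpl. ring.
  - intros t _. apply continuity_pt_filterlim. unfold K, N.
    destruct (continuous_components _ _ (Cwc t)) as [K1 K2].
    apply (continuous_mult (K := R_AbsRing)
             (fun s => (Re (w (clamp lo hi s)) ^ 2 + Im (w (clamp lo hi s)) ^ 2)%R)
             (fun s => exp (- (2 * M * sg * s)))).
    + assert (Sq : forall u : R -> R, continuous u t -> continuous (fun s => (u s ^ 2)%R) t).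
      { intros u Hu. apply (continuous_ext (fun s => (u s * u s)%R)); [intros; simpl; ring|].
        now apply (continuous_mult (K := R_AbsRing) u u). }
      now apply (continuous_plus (V := R_NormedModule) (fun s => (Re (w (clamp lo hi s)) ^ 2)%R)
               (fun s => (Im (w (clamp lo hi s)) ^ 2)%R)); apply Sq.
    + apply (ex_derive_continuous (K := R_AbsRing) (V := R_NormedModule)). now auto_derive.
  - fold lo hi in Hc.
    assert (K0 : K 0%R = 0%R).
    { unfold K, N. rewrite clamp_id, w0; [simpl; ring|].
      unfold lo, hi, Rmin, Rmax. destruct (Rle_dec 0 T); lra. }
    assert (HK : (dK c * (T - 0) <= 0)%R).
    { rewrite Rminus_0_r, Hsg. unfold dK.
      set (e := exp (- (2 * M * sg * c))).
      assert (Pe : (0 < e)%R) by apply exp_pos.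
      set (q := (Re (w c) * Re (a c * w c) + Im (w c) * Im (a c * w c))%R).
      assert (Hn : (Re (w c) ^ 2 + Im (w c) ^ 2 = Cmod (w c) ^ 2)%R) by (symmetry; exact (Cmod2_alt (w c))).
      assert (Hq : (q = Re (a c) * Cmod (w c) ^ 2)%R).
      { rewrite <- Hn. unfold q. destruct (a c), (w c). unfold Re, Im. simpl. ring. }
      rewrite Hn, Hq.
      pose proof (re_le_Cmod (a c)) as H1. pose proof (HM c Hc) as H2.
      assert (H3 : (sg * Re (a c) <= M)%R).
      { apply Rabs_le_between in H1. unfold sg. destruct (Rle_dec 0 T); lra. }
      replace ((2 * (Re (a c) * Cmod (w c) ^ 2) - 2 * M * sg * Cmod (w c) ^ 2) * e * (sg * Rabs T))%R
        with (- (2 * (M * (sg * sg) - sg * Re (a c)) * (Cmod (w c) ^ 2 * e * Rabs T)))%R by ring.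
      rewrite Hsg2.
      assert (0 <= Cmod (w c) ^ 2 * e * Rabs T)%R.
      { apply Rmult_le_pos; [apply Rmult_le_pos; [apply pow2_ge_0|lra]|apply Rabs_pos]. }
      nra. }
    rewrite <- EK, K0 in HK. unfold K, N in HK.
    rewrite clamp_id in HK
      by (unfold lo, hi, Rmin, Rmax; destruct (Rle_dec 0 T); lra).
    pose proof (exp_pos (- (2 * M * sg * T))) as Pe.
    apply Cmod_eq_0.
    assert (Hn : (Cmod (w T) ^ 2 = Re (w T) ^ 2 + Im (w T) ^ 2)%R) by exact (Cmod2_alt (w T)).
    rewrite <- Hn in HK. pose proof (Cmod_ge_0 (w T)).
    assert (Cmod (w T) ^ 2 <= 0)%R by nra.
    nra.
Qed.

(** * The Riccati system *)

Lemma is_derive_in_eq (I : R -> Prop) (f : R -> C) (t : R) (l m : C) :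
  l = m -> is_derive_in I f t l -> is_derive_in I f t m.
Proof. now intros ->. Qed.

Lemma is_derive_in_affine (I : R -> Prop) (a b : C) (f : R -> C) (t : R) (l : C) :
  I t -> is_derive_in I f t l -> is_derive_in I (fun s => a + b * f s) t (b * l).
Proof.
  intros It Df.
  apply (is_derive_in_eq I _ t (0 + (0 * f t + b * l))); [ring|].
  apply is_derive_in_plus; [exact It|now apply is_derive_in_const|].
  apply is_derive_in_mult; [exact It|now apply is_derive_in_const|exact Df].
Qed.

(** The difference [d = y - z] of two solutions satisfies the linear equation
    [d' = (b + y + z) d]. *)
Lemma riccati_unique (I : R -> Prop) (b c y z : R -> C) :
  is_interval I -> I 0%R ->
  continuous_on (T := R_UniformSpace) (U := C_UniformSpace) I b ->
  (forall t, I t -> is_derive_in I y t (c t + b t * y t + y t ^ 2)) ->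
  (forall t, I t -> is_derive_in I z t (c t + b t * z t + z t ^ 2)) ->
  y 0%R = z 0%R -> forall t, I t -> y t = z t.
Proof.
  intros HI I0 Cb Dy Dz E0 t It.
  assert (H : y t + - (1) * z t = 0).
  { apply (linear_ode_zero I (fun s => y s + - (1) * z s) (fun s => b s + (y s + z s)) HI I0);
      [| |rewrite E0; ring|exact It].
    - intros s Is.
      apply Clim_plus; [typeclasses eauto|exact (Cb s Is)|].
      apply Clim_plus; [typeclasses eauto| |]; eapply is_derive_in_continuous; eauto.
    - intros s Is.
      apply (is_derive_in_eq I _ s ((c s + b s * y s + y s ^ 2)
               + (0 * z s + - (1) * (c s + b s * z s + z s ^ 2)))); [ring|].
      apply is_derive_in_plus; [exact Is|now apply Dy|].
      apply is_derive_in_mult; [exact Is|now apply is_derive_in_const|now apply Dz]. }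
  replace (y t) with ((y t + - (1) * z t) + z t) by ring. rewrite H. ring.
Qed.

(** The system is triangular: each component solves a scalar Riccati equation,
    the first one autonomous, the second with coefficients given by the first.
    A single solution therefore determines them all on the interval. *)
Lemma ivp_solution_iff (rho1 rho2 y10 y20 : C) (I : R -> Prop) (z1 z2 y1 y2 : R -> C) :
  is_interval I -> I 0%R ->
  is_ivp_solution rho1 rho2 I y10 y20 z1 z2 ->
  is_ivp_solution rho1 rho2 I y10 y20 y1 y2 <->
  (forall t, I t -> y1 t = z1 t /\ y2 t = z2 t).
Proof.
  intros HI I0 [Z10 [Z20 DZ]]. split.
  - intros [Y10 [Y20 DY]].
    assert (E1 : forall t, I t -> y1 t = z1 t).
    { apply (riccati_unique I (fun _ => 0) (fun _ => 0) _ _ HI I0).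
      - intros s Is. apply (Clim_const (near I s)).
      - intros s Is. refine (is_derive_in_eq _ _ _ _ _ _ (proj1 (DY s Is))). ring.
      - intros s Is. refine (is_derive_in_eq _ _ _ _ _ _ (proj1 (DZ s Is))). ring.
      - congruence. }
    assert (E2 : forall t, I t -> y2 t = z2 t).
    { apply (riccati_unique I (fun s => rho2 * z1 s) (fun s => rho1 * z1 s ^ 2) _ _ HI I0).
      - intros s Is. apply Clim_mult; [typeclasses eauto|apply (Clim_const (near I s))|].
        exact (is_derive_in_continuous I s Is z1 _ (proj1 (DZ s Is))).
      - intros s Is. rewrite <- (E1 s Is). exact (proj2 (DY s Is)).
      - intros s Is. exact (proj2 (DZ s Is)).
      - congruence. }
    intros t It. split; [now apply E1 | now apply E2].
  - intros E. split; [|split].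
    + rewrite <- Z10. now apply E.
    + rewrite <- Z20. now apply E.
    + intros t It. split.
      * apply (is_derive_in_ext I t It z1); [intros s Is; symmetry; now apply E|].
        rewrite (proj1 (E t It)). exact (proj1 (DZ t It)).
      * apply (is_derive_in_ext I t It z2); [intros s Is; symmetry; now apply E|].
        rewrite (proj1 (E t It)), (proj2 (E t It)). exact (proj2 (DZ t It)).
Qed.

Lemma is_derive_in_pole (I : R -> Prop) (y : C) (t : R) :
  I t -> 1 - y * t <> 0 ->
  is_derive_in I (fun s => y / (1 - y * s)) t ((y / (1 - y * t)) ^ 2).
Proof.
  intros It N.
  assert (D : is_derive_in I (fun s => 1 - y * s) t (- y)).
  { apply (is_derive_in_ext I t It (fun s => 1 + - y * s)); [intros; ring|].
    apply (is_derive_in_eq I _ t (- y * 1)); [ring|].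
    now apply is_derive_in_affine, is_derive_in_id. }
  apply (is_derive_in_ext I t It (fun s => 0 + y * / (1 - y * s))).
  { intros s _. unfold Cdiv. ring. }
  apply (is_derive_in_eq I _ t (y * (- - y / ((1 - y * t) * (1 - y * t))))); [now field|].
  apply is_derive_in_affine; [exact It|].
  now apply (is_derive_in_inv I t It (fun s : R => 1 - y * s)).
Qed.

Lemma is_derive_in_power_branch (I : R -> Prop) (y alpha : C) (P : R -> C) (t : R) :
  is_power_branch I (fun t => 1 - y * t) alpha P -> I t ->
  is_derive_in I P t (- alpha * (y / (1 - y * t)) * P t).
Proof.
  intros [[L [CL HL]] _] It.
  apply (is_derive_in_eq I _ t (alpha * ((- y * 1) / (1 - y * t)) * P t)).
  { unfold Cdiv. ring. }
  apply (is_derive_in_power I (fun s : R => 1 - y * s) L P alpha _ t It CL HL).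
  apply (is_derive_in_ext I t It (fun s => 1 + - y * s)); [intros; ring|].
  now apply is_derive_in_affine, is_derive_in_id.
Qed.

(** In terms of the roots, [rho1 = up * um] and [rho2 = 1 - up - um], and for
    [y2 = y1 * u] the second equation reads [u' = y1 (u - up) (u - um)].  The
    quotient below satisfies it because [P' = (up - um) y1 P]. *)
Lemma explicit_formula_solves (up um y10 y20 : C) (I : R -> Prop) (P : R -> C) :
  I 0%R -> up - um <> 0 -> y10 <> 0 ->
  (forall t : R, I t -> 1 - y10 * t <> 0) ->
  is_power_branch I (fun t => 1 - y10 * t) (- (up - um)) P ->
  let u0 := y20 / y10 in
  (forall t : R, I t -> u0 - um - (u0 - up) * P t <> 0) ->
  is_ivp_solution (up * um) (1 - up - um) I y10 y20
    (fun t => y10 / (1 - y10 * t))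
    (fun t => y10 / (1 - y10 * t) *
       ((up * (u0 - um) - um * (u0 - up) * P t) / (u0 - um - (u0 - up) * P t))).
Proof.
  intros I0 ND Ny N HP u0 ND'.
  assert (P0 : P 0%R = 1) by apply HP.
  split; [|split].
  - replace (1 - y10 * 0%R) with (RtoC 1) by ring. field.
  - rewrite P0. replace (1 - y10 * 0%R) with (RtoC 1) by ring.
    replace (u0 - um - (u0 - up) * 1) with (up - um) by ring.
    unfold u0. field. now split.
  - intros t It. specialize (N t It). specialize (ND' t It).
    pose proof (is_derive_in_pole I y10 t It N) as D1.
    split; [exact D1|].
    pose proof (is_derive_in_power_branch I y10 _ P t HP It) as DP.
    set (A := u0 - um) in *. set (B := u0 - up) in *.
    assert (DN : is_derive_in I (fun s => up * A - um * B * P s) t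
                   (- (um * B) * (- - (up - um) * (y10 / (1 - y10 * t)) * P t))).
    { apply (is_derive_in_ext I t It (fun s => up * A + - (um * B) * P s)); [intros; ring|].
      now apply is_derive_in_affine. }
    assert (DD : is_derive_in I (fun s => A - B * P s) t
                   (- B * (- - (up - um) * (y10 / (1 - y10 * t)) * P t))).
    { apply (is_derive_in_ext I t It (fun s => A + - B * P s)); [intros; ring|].
      now apply is_derive_in_affine. }
    pose proof (is_derive_in_inv I t It _ _ ND' DD) as DI.
    pose proof (is_derive_in_mult I t It _ _ _ _ D1
                  (is_derive_in_mult I t It _ _ _ _ DN DI)) as D2.
    refine (is_derive_in_eq _ _ _ _ _ _ D2).
    assert (EAB : up - um = A - B) by (unfold A, B; ring).
    field. now split.
Qed.

Theorem mainTheorem1 :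
  forall rho1 rho2 Delta up um : C,
  Delta ^ 2 = (1 - rho2) ^ 2 - 4 * rho1 ->
  up = (1 - rho2 + Delta) / 2 ->
  um = (1 - rho2 - Delta) / 2 ->
  Delta <> 0 ->
  forall (y10 y20 : C) (I : R -> Prop),
  is_interval I -> I 0%R ->
  (y10 <> 0 ->
   (forall t : R, I t -> 1 - y10 * t <> 0) ->
   (exists P : R -> C, is_power_branch I (fun t => 1 - y10 * t) (- Delta) P) /\
   (forall P : R -> C,
    is_power_branch I (fun t => 1 - y10 * t) (- Delta) P ->
    let u0 := y20 / y10 in
    (forall t : R, I t -> u0 - um - (u0 - up) * P t <> 0) ->
    forall y1 y2 : R -> C,
    is_ivp_solution rho1 rho2 I y10 y20 y1 y2 <->
    (forall t : R, I t ->
       y1 t = y10 / (1 - y10 * t) /\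
       y2 t = y10 / (1 - y10 * t) *
              ((up * (u0 - um) - um * (u0 - up) * P t) /
               (u0 - um - (u0 - up) * P t)))))
  /\
  (y10 = 0 ->
   (forall t : R, I t -> 1 - y20 * t <> 0) ->
   forall y1 y2 : R -> C,
   is_ivp_solution rho1 rho2 I y10 y20 y1 y2 <->
   (forall t : R, I t -> y1 t = 0 /\ y2 t = y20 * / (1 - y20 * t))).
Proof.
  intros rho1 rho2 Delta up um HD Hup Hum ND y10 y20 I HI I0.
  assert (N2 : RtoC 2 <> 0).
  { intros K. apply RtoC_inj in K. lra. }
  assert (ED : Delta = up - um) by (rewrite Hup, Hum; field; exact N2).
  assert (E2 : rho2 = 1 - up - um) by (rewrite Hup, Hum; field; exact N2).
  assert (E1 : rho1 = up * um).
  { transitivity (((1 - rho2) ^ 2 - Delta ^ 2) * / 2 * / 2).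
    - rewrite HD. now field.
    - rewrite Hup, Hum. now field. }
  split.
  - intros Ny N. split; [now apply power_branch_exists|].
    intros P HP u0 NP y1 y2.
    apply (ivp_solution_iff rho1 rho2 y10 y20 I
             (fun t => y10 / (1 - y10 * t))
             (fun t => y10 / (1 - y10 * t) *
                ((up * (u0 - um) - um * (u0 - up) * P t) /
                 (u0 - um - (u0 - up) * P t))) y1 y2 HI I0).
    rewrite ED in HP, ND. rewrite E1, E2. now apply explicit_formula_solves.
  - intros Ey N y1 y2.
    apply (ivp_solution_iff rho1 rho2 y10 y20 I
             (fun _ => 0) (fun t => y20 * / (1 - y20 * t)) y1 y2 HI I0).
    split; [now rewrite Ey|]. split.
    + replace (1 - y20 * 0%R) with (RtoC 1) by ring. field.
    + intros t It. split.
      * apply (is_derive_in_eq I _ t 0); [ring|]. now apply is_derive_in_const.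
      * apply (is_derive_in_eq I _ t ((y20 / (1 - y20 * t)) ^ 2));
          [unfold Cdiv; ring|].
        apply is_derive_in_pole; [exact It|now apply N].
Qed.
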